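(* Let $\alpha\in(0,1]$ and suppose the candidate-family process $\mathcal C=(\mathcal C_t)_{t\ge0}$ controls simultaneous SupFDR at level $\alpha$. For every nonempty finite $S\subseteq\mathcal I$, define $$\overline E_t^{S,\mathrm{can}}:=\frac1\alpha\max_{0\le u\le t}\ \max_{R\in\mathcal C_u}\mathrm{FDP}_{S\cap I_u}(R).$$ Then $\overline{\mathbf E}^{\mathrm{can}}=(\overline E^{S,\mathrm{can}}_t)$ is a future-extension coherent, time-monotone dynamic intersection $e$-process collection and $$\mathcal C_t\subseteq\mathfrak R_{\alpha,t}(\overline{\mathbf E}^{\mathrm{can}})\qquad\text{for every }t .$$
   Context: Let $(\Omega,\mathcal F,(\mathcal F_t)_{t\in\mathbb N_0})$ be a discrete-time filtered measurable space, $\mathcal M$ a family of probability measures on $(\Omega,\mathcal F)$, $\mathcal I\subseteq\mathbb N$ an index set (finite or infinite), and $H_i\subseteq\mathcal M$, $i\in\mathcal I$, null hypotheses. Put $\mathcal N(P)=\{i\in\mathcal I:P\in H_i\}$ and, for finite $S\subseteq\mathcal I$, $H_S=\bigcap_{i\in S}H_i$ (with $H_\varnothing=\mathcal M$). The active sets $I_t\subseteq\mathcal I$ are deterministic and finite with $I_0\subseteq I_1\subseteq\cdots$ and $\bigcup_t I_t=\mathcal I$. For a finite $R\subseteq\mathcal I$ and any $S\subseteq\mathcal I$, $\mathrm{FDP}_S(R)=|S\cap R|/(|R|\vee 1)$. A candidate-family process $\mathcal C=(\mathcal C_t)_{t\ge0}$ consists of nonempty random families $\mathcal C_t\subseteq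 2^{I_t}$ with $\{R\in\mathcal C_t\}\in\mathcal F_t$ for every deterministic $R\subseteq I_t$. It controls simultaneous SupFDR at level $\alpha$ if $\mathbb E_P[\sup_{t\ge0}\max_{R\in\mathcal C_t}\mathrm{FDP}_{\mathcal N(P)\cap I_t}(R)]\le\alpha$ for every $P\in\mathcal M$. A nonnegative $(\mathcal F_t)$-adapted process $E=(E_t)_{t\ge0}$ is an $e$-process for $H\subseteq\mathcal M$ if $\mathbb E_P[E_\tau]\le1$ for every $P\in H$ and every $(\mathcal F_t)$-stopping time $\tau$ with $P(\tau<\infty)=1$. A dynamic intersection $e$-process collection is a family $\mathbf E=(E^S_t)_{t\ge0,\ S\subseteq\mathcal I,\ 0<|S|<\infty}$ such that $E^S$ is an $e$-process for $H_S$ for each nonempty finite $S$. It is future-extension coherent if, pointwise on $\Omega$, $E_t^{S\cap I_t}\le E_t^S$ for every $t$ and every finite $S$ with $S\cap I_t\ne\varnothing$. It is time-monotone if, pointwise on $\Omega$, $E^S_t\le E^S_u$ for all $t\le u$ and every finite nonempty $S$. The closure family at time $t$ is $\mathfrak R_{\alpha,t}(\mathbf E)=\{R\subseteq I_t:\ \mathrm{FDP}_S(R)\le\alpha E^S_t\text{ for every nonempty }S\subseteq I_t\}$. *)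

(* Defs.v *)
From HB Require Import structures.
From mathcomp Require Import all_boot all_order all_algebra finmap.
From mathcomp Require Import all_classical all_reals all_analysis.

Set Implicit Arguments.
Unset Strict Implicit.
Unset Printing Implicit Defensive.

Import Order.TTheory GRing.Theory Num.Theory.

Local Open Scope classical_set_scope.
Local Open Scope ring_scope.

(* Hypotheses are labelled by natural numbers.  Finite sets of labels are
   [{fset nat}]; the index set and N(P), which may be infinite, are [set nat]. *)

Definition filtration d (T : measurableType d) (F : nat -> set (set T)) : Prop :=
  [/\ forall t, sigma_algebra [set: T] (F t),
      forall t, F t `<=` measurable
    & forall s t, (s <= t)%N -> F s `<=` F t].

Definition adapted d (T : measurableType d) (R : realType)
    (F : nat -> set (set T)) (X : nat -> T -> R) : Prop :=
  forall t (B : set R), measurable B -> F t (X t @^-1` B).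

(* Random times take values in [option nat], with [None] for infinity. *)
Definition stopping_time d (T : measurableType d) (F : nat -> set (set T))
    (tau : T -> option nat) : Prop :=
  forall t, F t [set w | exists2 s, tau w = Some s & (s <= t)%N].

(* The value on {tau = infinity} is a convention; it is only ever integrated
   against laws under which that event is null. *)
Definition stopped (T : Type) (R : realType) (X : nat -> T -> R)
    (tau : T -> option nat) (w : T) : R :=
  if tau w is Some t then X t w else 0.

Definition is_eprocess d (T : measurableType d) (R : realType)
    (F : nat -> set (set T)) (H : set (probability T R))
    (X : nat -> T -> R) : Prop :=
  [/\ forall t w, 0 <= X t w,
      adapted F X
    & forall (P : probability T R) (tau : T -> option nat),
        H P -> stopping_time F tau -> P [set w | tau w <> None] = 1%E ->
        (\int[P]_w (stopped X tau w)%:E <= 1)%E].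

Definition true_nulls d (T : measurableType d) (R : realType) (I : set nat)
    (H : nat -> set (probability T R)) (P : probability T R) : set nat :=
  [set i | I i /\ H i P].

Definition intersection_null d (T : measurableType d) (R : realType)
    (M : set (probability T R)) (H : nat -> set (probability T R))
    (S : {fset nat}) : set (probability T R) :=
  [set P | M P /\ forall i, i \in S -> H i P].

Definition active_sets (I : set nat) (Iact : nat -> {fset nat}) : Prop :=
  (forall s t, (s <= t)%N -> (Iact s `<=` Iact t)%fset) /\
  \bigcup_t [set` Iact t] = I.

Definition FDP (R : realType) (S : set nat) (D : {fset nat}) : R :=
  #|` [fset i in D | i \in S]%fset |%:R / (maxn #|` D| 1)%:R.

(* As FDP >= 0, folding from 0 gives the maximum of FDP_S over any nonempty
   family. *)
Definition max_FDP (R : realType) (S : set nat) (C : {fset {fset nat}}) : R :=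
  \big[Num.max/0]_(D <- C) FDP R S D.

Definition candidate_process d (T : measurableType d) (F : nat -> set (set T))
    (Iact : nat -> {fset nat}) (C : nat -> T -> {fset {fset nat}}) : Prop :=
  [/\ forall t w, C t w != fset0,
      forall t w D, D \in C t w -> (D `<=` Iact t)%fset
    & forall t D, (D `<=` Iact t)%fset -> F t [set w | D \in C t w]].

Definition controls_SupFDR d (T : measurableType d) (R : realType)
    (M : set (probability T R)) (I : set nat)
    (H : nat -> set (probability T R)) (Iact : nat -> {fset nat})
    (C : nat -> T -> {fset {fset nat}}) (alpha : R) : Prop :=
  forall P : probability T R, M P ->
    (\int[P]_w ereal_sup
       (range (fun t : nat =>
          (max_FDP R (true_nulls I H P `&` [set` Iact t]) (C t w))%:E))
     <= alpha%:E)%E.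

(* Families of processes are written [E S t w] for E^S_t(w).  They are total in
   S, but only the nonempty finite S included in the index set matter. *)
Definition intersection_eprocess_collection d (T : measurableType d)
    (R : realType) (F : nat -> set (set T)) (M : set (probability T R))
    (I : set nat) (H : nat -> set (probability T R))
    (E : {fset nat} -> nat -> T -> R) : Prop :=
  forall S : {fset nat}, [set` S] `<=` I -> S != fset0 ->
    is_eprocess F (intersection_null M H S) (E S).

Definition future_extension_coherent (T : Type) (R : realType) (I : set nat)
    (Iact : nat -> {fset nat}) (E : {fset nat} -> nat -> T -> R) : Prop :=
  forall (t : nat) (S : {fset nat}) (w : T), [set` S] `<=` I ->
    (S `&` Iact t)%fset != fset0 -> E (S `&` Iact t)%fset t w <= E S t w.

Definition time_monotone (T : Type) (R : realType) (I : set nat)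
    (E : {fset nat} -> nat -> T -> R) : Prop :=
  forall (t u : nat) (S : {fset nat}) (w : T), (t <= u)%N ->
    [set` S] `<=` I -> S != fset0 -> E S t w <= E S u w.

Definition closure_family (T : Type) (R : realType) (Iact : nat -> {fset nat})
    (alpha : R) (E : {fset nat} -> nat -> T -> R) (t : nat) (w : T) :
    set {fset nat} :=
  [set D | (D `<=` Iact t)%fset /\
     forall S : {fset nat}, S != fset0 -> (S `<=` Iact t)%fset ->
       FDP R [set` S] D <= alpha * E S t w].

Definition canonical_E (T : Type) (R : realType) (Iact : nat -> {fset nat})
    (C : nat -> T -> {fset {fset nat}}) (alpha : R)
    (S : {fset nat}) (t : nat) (w : T) : R :=
  alpha^-1 * \big[Num.max/0]_(u < t.+1)
               max_FDP R [set` (S `&` Iact u)%fset] (C u w).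

(* Main.v *)
Require Import Defs.
From HB Require Import structures.
From mathcomp Require Import all_boot all_order all_algebra finmap.
From mathcomp Require Import all_classical all_reals all_analysis.
From mathcomp Require Import measurable_realfun.

Local Open Scope classical_set_scope.
Local Open Scope ring_scope.

(** The canonical process is [1 / alpha] times a running maximum, and everything
    follows from comparing FDPs before taking that maximum.

    FDP is monotone in its set of nulls and the maximum runs over more times as
    [t] grows; hence [canonical_E] is monotone in [S] and in [t] at once
    ([le_canonical_E]), which gives both coherence and time monotonicity.  A
    candidate [D] at time [t] is one of the competitors in the maximum at time
    [t], which is the membership in the closure family ([canonical_E_ge_FDP]).

    For the e-process property let [P] satisfy every hypothesis in [S].  Then
    [S] consists of true nulls of [P], so [alpha * canonical_E S t] is bounded,
    for all [t] simultaneously, by the supremum over all times of the maximal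
    FDP over the true nulls ([canonical_E_le_sup]).  So is its value at any
    stopping time, and no optional stopping argument is needed: integrating
    this pointwise bound and using SupFDR control gives
    [alpha * E_P[canonical_E S tau] <= alpha] ([canonical_E_eprocess]).

    What remains is measurability.  The candidates at time [t] lie in the finite
    powerset of the active set, so the maximum over the random family is a
    maximum over a fixed finite family of the terms switched on by the events
    that [D] is a candidate ([max_FDP_fpowerset]). *)

Set Implicit Arguments.
Unset Strict Implicit.
Unset Printing Implicit Defensive.

Import Order.TTheory GRing.Theory Num.Theory.

Lemma FDP_ge0 (R : realType) (S : set nat) (D : {fset nat}) : 0 <= FDP R S D.
Proof. by rewrite /FDP divr_ge0. Qed.

Lemma le_FDP (R : realType) (S S' : set nat) (D : {fset nat}) :
  S `<=` S' -> FDP R S D <= FDP R S' D.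
Proof.
move=> SS'; rewrite /FDP ler_wpM2r ?invr_ge0// ler_nat fsubset_leq_card//.
apply/fsubsetP => i; rewrite !inE => /andP[-> /set_mem iS].
exact/mem_set/SS'.
Qed.

Lemma max_FDP_ge0 (R : realType) (S : set nat) (C : {fset {fset nat}}) :
  0 <= max_FDP R S C.
Proof. exact: bigmax_ge_id. Qed.

Lemma FDP_le_max_FDP (R : realType) (S : set nat) (C : {fset {fset nat}})
    (D : {fset nat}) :
  D \in C -> FDP R S D <= max_FDP R S C.
Proof. by move=> DC; exact: le_bigmax_seq. Qed.

Lemma le_max_FDP (R : realType) (S S' : set nat) (C : {fset {fset nat}}) :
  S `<=` S' -> max_FDP R S C <= max_FDP R S' C.
Proof.
move=> SS'; rewrite [X in X <= _]/max_FDP big_seq.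
apply: bigmax_le => [|D DC]; first exact: max_FDP_ge0.
exact: le_trans (le_FDP R D SS') (FDP_le_max_FDP R S' DC).
Qed.

(** A maximum over the family [C], which will be random, becomes one over a
    deterministic index set; the default value 0 of the absent terms is harmless
    because FDP is nonnegative. *)
Lemma max_FDP_fpowerset (R : realType) (S : set nat) (A : {fset nat})
    (C : {fset {fset nat}}) :
  (forall D, D \in C -> (D `<=` A)%fset) ->
  max_FDP R S C =
  \big[Num.max/0]_(D <- fpowerset A) (if D \in C then FDP R S D else 0).
Proof.
move=> CA; apply/le_anti/andP; split; rewrite /max_FDP big_seq.
  apply: bigmax_le => [|D DC]; first exact: bigmax_ge_id.
  have DA : D \in fpowerset A by rewrite fpowersetE CA.
  by apply: (bigmax_sup_seq _ D) => //; rewrite DC.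
apply: bigmax_le => [|D _]; first exact: bigmax_ge_id.
by case: ifPn => [|_]; [exact: FDP_le_max_FDP | exact: bigmax_ge_id].
Qed.

Lemma measurable_bigmaxr d (T : measurableType d) (R : realType) (J : eqType)
    (s : seq J) (f : J -> T -> R) :
  (forall j, j \in s -> measurable_fun setT (f j)) ->
  measurable_fun setT (fun w => \big[Num.max/0]_(j <- s) f j w).
Proof.
elim: s => [|j s IH] mf.
  under eq_fun do rewrite big_nil.
  exact: measurable_cst.
under eq_fun do rewrite big_cons.
apply: measurable_maxr; first by apply: mf; rewrite mem_head.
by apply: IH => k ks; apply: mf; rewrite inE ks orbT.
Qed.

Lemma measurable_max_FDP d (T : measurableType d) (R : realType) (S : set nat)
    (A : {fset nat}) (C : T -> {fset {fset nat}}) :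
  (forall w D, D \in C w -> (D `<=` A)%fset) ->
  (forall D, (D `<=` A)%fset -> measurable [set w | D \in C w]) ->
  measurable_fun setT (fun w => max_FDP R S (C w)).
Proof.
move=> CA mC; under eq_fun => w do rewrite (max_FDP_fpowerset R S (CA w)).
apply: measurable_bigmaxr => D; rewrite fpowersetE => DA.
apply: measurable_fun_if => //.
by apply: (measurable_fun_bool true); rewrite setTI; exact: mC.
Qed.

(** The value at [tau] is measurable because it is read off countably many
    pieces: the events that [tau] equals [t], where it is [X t], and the event
    that [tau] is infinite, where it is constant. *)
Lemma measurable_stopped d (T : measurableType d) (R : realType)
    (F : nat -> set (set T)) (X : nat -> T -> R) (tau : T -> option nat) :
  (forall t, F t `<=` measurable) -> adapted F X -> stopping_time F tau ->
  measurable_fun setT (stopped X tau).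
Proof.
move=> Fm aX st.
(* [A t] is the event that [tau] is at most [t]; the event that [tau] equals [t]
   is what it adds to the earlier ones. *)
pose A t := [set w | exists2 s, tau w = Some s & (s <= t)%N].
have mA t : measurable (A t) by exact/Fm/st.
move=> _ B mB; rewrite setTI.
have -> : stopped X tau @^-1` B =
    (\bigcup_t ((A t `\` \bigcup_(s in [set s | (s < t)%N]) A s) `&` X t @^-1` B))
    `|` (~` (\bigcup_t A t) `&` [set w | B 0]).
  apply/seteqP; split=> w.
    rewrite /preimage /stopped /=; case tw: (tau w) => [t|] Bw.
      left; exists t => //; split=> //; split; first by exists t.
      move=> [s /= st' [r]]; rewrite tw => -[<-] ts.
      by move: st'; rewrite ltnNge ts.
    by right; split=> // -[t _ [s]]; rewrite tw.
  rewrite /preimage /stopped /= => -[[t _ [[[s tw st'] nlt] Xw]]|[nA B0]].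
    rewrite tw; have [//|] : s = t \/ (s < t)%N.
      by move: st'; rewrite leq_eqVlt => /orP[/eqP|]; [left|right].
      by move=> ->.
    by move=> slt; exfalso; apply: nlt; exists s => //; exists s.
  by case tw: (tau w) => [t|]//; exfalso; apply: nA; exists t => //; exists t.
apply: measurableU.
  apply: bigcup_measurable => t _; apply: measurableI; last exact/Fm/aX.
  by apply: measurableD => //; exact: bigcup_measurable.
apply: measurableI; first by apply/measurableC/bigcup_measurable.
have [B0|nB0] := pselect (B 0).
  by rewrite (_ : [set w | B 0] = setT)//; apply/seteqP; split.
by rewrite (_ : [set w | B 0] = set0)//; apply/seteqP; split.
Qed.

Lemma measurable_ereal_sup_range d (T : measurableType d) (R : realType)
    (f : nat -> T -> \bar R) :
  (forall t, measurable_fun setT (f t)) ->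
  measurable_fun setT (fun w => ereal_sup (range (f ^~ w))).
Proof.
move=> mf; have := measurable_fun_esups mf 0.
apply: eq_measurable_fun => w _; rewrite /esups; congr ereal_sup.
by apply/seteqP; split=> _ [t _ <-]; exists t.
Qed.

Lemma canonical_E_ge0 (T : Type) (R : realType) (Iact : nat -> {fset nat})
    (C : nat -> T -> {fset {fset nat}}) (alpha : R) S t w :
  0 <= alpha -> 0 <= canonical_E Iact C alpha S t w.
Proof.
by move=> a0; rewrite /canonical_E mulr_ge0 ?invr_ge0//; exact: bigmax_ge_id.
Qed.

(** The value at time [t] depends only on the candidate families at times up to
    [t], whose membership events all lie in [F t] since [F] is increasing. *)
Lemma adapted_canonical_E d (T : measurableType d) (R : realType)
    (F : nat -> set (set T)) (Iact : nat -> {fset nat})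
    (C : nat -> T -> {fset {fset nat}}) (alpha : R) (S : {fset nat}) :
  filtration F -> candidate_process F Iact C ->
  adapted F (canonical_E Iact C alpha S).
Proof.
move=> [sF _ incF] [_ CA FC] t B mB.
(* Measurability with respect to the sub-sigma-algebra [F t] is ordinary
   measurability on the space that carries only [F t]. *)
have mE : measurable_fun setT
    (canonical_E Iact C alpha S t : g_sigma_algebraType (F t) -> R).
  apply: measurable_funM => //; apply: measurable_bigmaxr => u _.
  apply: (@measurable_max_FDP _ _ _ _ (Iact u)) => [w D|D DA]; first exact: CA.
  apply: sub_sigma_algebra; apply: (incF u); last exact: FC.
  by rewrite -ltnS.
by have := mE measurableT B mB; rewrite setTI /measurable/= sigma_algebra_id.
Qed.

Lemma sup_max_FDP_ge0 (R : realType) (S : nat -> set nat)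
    (C : nat -> {fset {fset nat}}) :
  (0 <= ereal_sup (range (fun u : nat => (max_FDP R (S u) (C u))%:E)))%E.
Proof.
apply: (@le_trans _ _ (max_FDP R (S 0%N) (C 0%N))%:E).
  by rewrite lee_fin max_FDP_ge0.
by apply: ereal_sup_ubound; exists 0%N.
Qed.

(** If every hypothesis in [S] is a true null, enlarging [S] to the set [N] of
    true nulls only increases each FDP, so the running maximum behind the
    canonical process stays below the quantity whose expectation SupFDR
    control bounds.  The bound holds at every time and every outcome, which is
    why it survives evaluation at an arbitrary stopping time. *)
Lemma canonical_E_le_sup (T : Type) (R : realType) (N : set nat)
    (Iact : nat -> {fset nat}) (C : nat -> T -> {fset {fset nat}}) (alpha : R)
    (S : {fset nat}) t w :
  0 < alpha -> [set` S] `<=` N ->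
  ((alpha * canonical_E Iact C alpha S t w)%:E <=
   ereal_sup (range (fun u : nat =>
     (max_FDP R (N `&` [set` Iact u]) (C u w))%:E)))%E.
Proof.
move=> a0 SN; rewrite /canonical_E mulVKf ?gt_eqF//.
set s := ereal_sup _.
have ubs u : ((max_FDP R (N `&` [set` Iact u]) (C u w))%:E <= s)%E.
  by apply: ereal_sup_ubound; exists u.
elim/big_ind: _ => [|x y xs ys|u _].
- exact: sup_max_FDP_ge0.
- by have [] := leP x y.
- apply: le_trans (ubs u); rewrite lee_fin; apply: le_max_FDP => i /=.
  by rewrite inE => /andP[iS iI]; split=> //; exact: SN.
Qed.

(** Both sides are kept multiplied by [alpha], so that the hypothesis of SupFDR
    control applies to the supremum exactly as it stands. *)
Lemma canonical_E_eprocess d (T : measurableType d) (R : realType)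
    (F : nat -> set (set T)) (M : set (probability T R))
    (I : set nat) (H : nat -> set (probability T R))
    (Iact : nat -> {fset nat}) (C : nat -> T -> {fset {fset nat}}) (alpha : R) :
  filtration F -> candidate_process F Iact C -> 0 < alpha ->
  controls_SupFDR M I H Iact C alpha ->
  intersection_eprocess_collection F M I H (canonical_E Iact C alpha).
Proof.
move=> hF hC a0 hctrl S SI _.
have E0 t w : 0 <= canonical_E Iact C alpha S t w.
  exact/canonical_E_ge0/ltW.
have aE := adapted_canonical_E alpha S hF hC.
split=> // P tau [MP HP] st _.
case: hF hC => _ Fm _ [_ CA FC].
have mX := measurable_stopped Fm aE st.
set X := stopped _ _ in mX *.
have X0 w : 0 <= X w by rewrite /X /stopped; case: (tau w).
have SN : [set` S] `<=` true_nulls I H P.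
  by move=> i iS; split; [exact: SI | exact: HP].
have XE0 w : setT w -> (0 <= (X w)%:E)%E by rewrite lee_fin.
have mXE : measurable_fun setT (fun w => (X w)%:E) by exact/measurable_EFinP.
rewrite -(@lee_pmul2l _ alpha%:E)//= mule1 -ge0_integralZl_EFin//; last exact: ltW.
apply: le_trans (hctrl P MP); apply: ge0_le_integral => //.
- by move=> w _; rewrite mule_ge0// lee_fin// ltW.
- exact: measurable_funeM.
- apply: measurable_ereal_sup_range => u; apply/measurable_EFinP.
  apply: (@measurable_max_FDP _ _ _ _ (Iact u)) => [w D|D DA]; first exact: CA.
  by apply: Fm; exact: FC.
move=> w _; rewrite -EFinM /X /stopped; case: (tau w) => [t|].
  exact: canonical_E_le_sup.
by rewrite mulr0; exact: sup_max_FDP_ge0.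
Qed.

(** Joint monotonicity in the index set and in time, since coherence compares
    index sets and time monotonicity compares times. *)
Lemma le_canonical_E (T : Type) (R : realType) (Iact : nat -> {fset nat})
    (C : nat -> T -> {fset {fset nat}}) (alpha : R) (S S' : {fset nat})
    (t u : nat) w :
  0 <= alpha -> (S `<=` S')%fset -> (t <= u)%N ->
  canonical_E Iact C alpha S t w <= canonical_E Iact C alpha S' u w.
Proof.
move=> a0 /fsubsetP SS' tu; rewrite /canonical_E ler_wpM2l ?invr_ge0//.
apply: bigmax_le => [|v _]; first exact: bigmax_ge_id.
have vu : (v < u.+1)%N by exact: leq_trans (ltn_ord v) _.
apply: (bigmax_sup (Ordinal vu)) => //=; apply: le_max_FDP => i /=.
by rewrite !inE => /andP[/SS' -> ->].
Qed.

(** [D] competes in the last term of the running maximum, where intersecting [S]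
    with the active set leaves it unchanged. *)
Lemma canonical_E_ge_FDP (T : Type) (R : realType) (Iact : nat -> {fset nat})
    (C : nat -> T -> {fset {fset nat}}) (alpha : R) (S D : {fset nat}) t w :
  0 < alpha -> D \in C t w -> (S `<=` Iact t)%fset ->
  FDP R [set` S] D <= alpha * canonical_E Iact C alpha S t w.
Proof.
move=> a0 DC SI; rewrite /canonical_E mulVKf ?gt_eqF//.
apply: (bigmax_sup ord_max) => //=.
by rewrite (fsetIidPl SI); exact: FDP_le_max_FDP.
Qed.

Theorem theorem7p2 (R : realType) (d : measure_display) (T : measurableType d)
    (F : nat -> set (set T)) (M : set (probability T R))
    (I : set nat) (H : nat -> set (probability T R))
    (Iact : nat -> {fset nat}) (C : nat -> T -> {fset {fset nat}}) (alpha : R)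
    (hF : filtration F)
    (hH : forall i : nat, I i -> H i `<=` M)
    (hI : active_sets I Iact)
    (hC : candidate_process F Iact C)
    (halpha0 : 0 < alpha) (halpha1 : alpha <= 1)
    (hctrl : controls_SupFDR M I H Iact C alpha) :
  let E := canonical_E Iact C alpha in
  [/\ intersection_eprocess_collection F M I H E,
      future_extension_coherent I Iact E,
      time_monotone I E
    & forall (t : nat) (w : T), [set` C t w] `<=` closure_family Iact alpha E t w].
Proof.
move=> E; have a0 := ltW halpha0; split.
- exact: canonical_E_eprocess.
- by move=> t S w _ _; apply: le_canonical_E => //; exact: fsubsetIl.
- by move=> t u S w tu _ _; exact: le_canonical_E.
- move=> t w D /= DC; case: hC => _ CA _; split; first exact: CA DC.
  by move=> S _ SI; exact: canonical_E_ge_FDP.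
Qed.
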